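(* Let $T_2 \subseteq \mathbb{R}^2$ be the triangle with vertices $(0,0)$, $(1,0)$ and $(0,1)$, and let $c_2 = (1/2, 1/2)$ be the midpoint of the edge $\{(x,y) : x, y \geq 0,\ x + y = 1\}$. Then $\mathbb{E} V_{T_2[2],c_2}^k < \mathbb{E} V_{T_2[2]}^k$ for each positive integer $k$.
   Context: For a triangle $T$ and a point $x \in T$, $V_{T[2]}$ denotes the distance $\|X_0 - X_1\|$ between two independent random points $X_0, X_1$ uniformly distributed in $T$, and $V_{T[2],x}$ denotes the distance $\|X_1 - x\|$ between a uniformly distributed random point $X_1$ in $T$ and the fixed point $x$. $\mathbb{E} V^k$ denotes $\mathbb{E}[V^k]$. *)

(* Defs.v *)
From HB Require Import structures.
From mathcomp Require Import all_boot all_order all_algebra.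
From mathcomp Require Import all_classical all_reals all_analysis.

Set Implicit Arguments.
Unset Strict Implicit.
Unset Printing Implicit Defensive.

Import Order.TTheory GRing.Theory Num.Theory.
Import numFieldNormedType.Exports.

Local Open Scope classical_set_scope.
Local Open Scope ring_scope.

(* [R * R] with the Borel sigma-algebra, built on the copy [measurableTypeR R] of
   [R] that carries [lebesgue_measure]. *)
Notation plane R := (measurableTypeR R * measurableTypeR R)%type.

(* The library norm on [R * R] is the sup norm, hence this definition. *)
Definition eucl_dist {R : realType} (p q : R * R) : R :=
  Num.sqrt ((p.1 - q.1) ^+ 2 + (p.2 - q.2) ^+ 2).

(* The convex hull of [a], [b] and [c]. *)
Definition triangle {R : realType} (a b c : R * R) : set (R * R) :=
  [set z | exists s t u : R,
    [/\ 0 <= s, 0 <= t, 0 <= u, s + t + u = 1 &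
        z = (s * a.1 + t * b.1 + u * c.1, s * a.2 + t * b.2 + u * c.2)]].

Definition T2 {R : realType} : set (R * R) := triangle (0, 0) (1, 0) (0, 1).

Definition c2 {R : realType} : R * R := (1 / 2, 1 / 2).

Definition area {R : realType} (A : set (plane R)) : \bar R :=
  (lebesgue_measure \x lebesgue_measure)%E A.

Section RandomPoints.
Context {R : realType} {d : measure_display} {Om : measurableType d}
  {P : probability Om R}.

(* The law of [X] is the normalized area on [D]; in particular [X] lies in [D]
   almost surely, not necessarily everywhere. Intended for [D] measurable with
   [0 < area D < +oo]. *)
Definition uniform_in (X : {RV P >-> plane R}) (D : set (plane R)) : Prop :=
  forall A : set (plane R), measurable A ->
    distribution P X A = (area (A `&` D) / area D)%E.

Definition independent_points (X Y : {RV P >-> plane R}) : Prop :=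
  forall A B : set (plane R), measurable A -> measurable B ->
    P (X @^-1` A `&` Y @^-1` B) = (P (X @^-1` A) * P (Y @^-1` B))%E.

End RandomPoints.

(* Main.v *)
Require Import Defs.
From HB Require Import structures.
From mathcomp Require Import all_boot all_order all_algebra.
From mathcomp Require Import all_classical all_reals all_analysis.
From mathcomp Require Import unstable measurable_realfun ring lra.

Import Order.TTheory GRing.Theory Num.Theory.
Import numFieldNormedType.Exports.

Local Open Scope classical_set_scope.
Local Open Scope ring_scope.

(* The altitude from the right angle cuts [T2] into two copies of itself, scaled by
   [1 / sqrt 2] and meeting at [c2], so the uniform law is the average of its images under
   the two similarities.  With [rho = 2 ^ (- k / 2)], splitting one or both points gives
   [E |Y - c2|^k = rho * E r^k] and [(2 - rho) * E |X0 - X1|^k = rho * E |X0 - X1^*|^k],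
   where [r] is the distance to the right angle and [^*] reflects one coordinate.  It
   remains to see that [(2 - rho) * E r^k < E |X0 - X1^*|^k].
   For [k >= 2], exchanging the coordinates of both points turns
   [|X0 - X1^*|^2 = S + 2 W] into [S - 2 W] with [S = |X0|^2 + |X1|^2]; convexity and
   superadditivity of [t ^ (k / 2)] then give [E |X0 - X1^*|^k >= 2 * E r^k].
   For [k = 1] both sides are compared with piecewise polynomial functions, whose
   means are again determined by the self-similarity alone. *)

(** * Lebesgue measure under affine maps of the line *)

Definition image_measure {d d'} {X : measurableType d} {Y : measurableType d'}
    {R : realType} (m : {measure set X -> \bar R}) (f : X -> Y)
    (mf : measurable_fun setT f) : {measure set Y -> \bar R} :=
  measure_function_pushforward__canonical__measure_function_Measure m mf.

(** The image measure rescaled by [|a|] gives half-open intervals their length, and that property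
    characterizes Lebesgue measure. *)
Lemma lebesgue_measure_affine (R : realType) (a b : R) (A : set (measurableTypeR R)) :
  a != 0 -> measurable A ->
  lebesgue_measure ((fun x : measurableTypeR R => a * x + b : measurableTypeR R) @^-1` A)
  = (`|a|^-1%:E * lebesgue_measure A)%E.
Proof.
move=> a0 mA; pose f (x : measurableTypeR R) : measurableTypeR R := a * x + b.
have mf : measurable_fun setT f.
  by apply: measurable_funD => //; exact: measurable_funM.
pose m : {measure set measurableTypeR R -> \bar R} :=
  mscale (NngNum (normr_ge0 a)) (image_measure (@lebesgue_measure R) _ mf).
suff -> : lebesgue_measure A = m A.
  by rewrite /m /= /mscale/= /image_measure /= /pushforward /= muleA -EFinM mulVf ?normr_eq0// mul1e.
apply: lebesgue_measure_unique => // _ [[x y] /= _ <-].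
rewrite /m /mscale /= /image_measure /= /pushforward.
have [a_gt0|a_lt0|/eqP] := ltgtP 0 a; last by rewrite eq_sym (negbTE a0).
- have -> : f @^-1` `]x, y] = `](x - b) / a, (y - b) / a]%classic.
    apply/seteqP; split => z /=; rewrite !in_itv/= /f ltr_pdivrMr// ler_pdivlMr//;
      by rewrite ltrBlDr lerBrDr mulrC.
  rewrite !lebesgue_measure_itv/= !lte_fin ltr_pM2r ?invr_gt0// ltrD2r.
  by case: ifPn => _; rewrite ?mule0// -!EFinB -EFinM; congr EFin; rewrite /= gtr0_norm//; field; rewrite gt_eqF.
(* A negative slope moves the closed end of the interval to the left; the length is unaffected. *)
- have -> : f @^-1` `]x, y] = `[(y - b) / a, (x - b) / a[%classic.
    apply/seteqP; split => z /=; rewrite !in_itv/= /f ltr_ndivlMr// ler_ndivrMr//;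
      by rewrite ltrBlDr lerBrDr mulrC andbC.
  rewrite !lebesgue_measure_itv/= !lte_fin ltr_nM2r ?invr_lt0// ltrD2r.
  by case: ifPn => _; rewrite ?mule0// -!EFinB -EFinM; congr EFin; rewrite /= ltr0_norm//; field; rewrite lt_eqF.
Qed.

(** * Plane area and the two similarities of the triangle *)

Section Area.
Context {R : realType}.
Implicit Types S : set (plane R).

Definition area_measure : {measure set (plane R) -> \bar R} :=
  (lebesgue_measure \x lebesgue_measure)%E.

(** Fubini: on each vertical fibre the map is affine with slope [a], so the one-dimensional rule
    applies under the integral. This covers shears, vertical scalings and reflections. *)
Lemma area_fiberwise_affine (a : R) (h : measurableTypeR R -> measurableTypeR R) S :
  a != 0 -> measurable_fun setT h -> measurable S ->
  area ((fun z : plane R => (z.1, a * z.2 + h z.1) : plane R) @^-1` S)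
  = (`|a|^-1%:E * area S)%E.
Proof.
move=> a0 mh mS; rewrite /area /product_measure1 -ge0_integralZl//=; last first.
  exact: (@measurable_fun_xsection _ _ _ _ R lebesgue_measure _ mS).
apply: eq_integral => x _ /=; rewrite -(@lebesgue_measure_affine _ _ (h x))//.
exact: measurable_xsection.
Qed.

Lemma area_swap S : measurable S -> area (swap @^-1` S : set (plane R)) = area S.
Proof.
move=> mS; apply/esym.
apply: (@product_measure_unique _ _ _ _ R lebesgue_measure lebesgue_measure
  (image_measure area_measure (swap : plane R -> plane R) (@measurable_swap _ _ _ _))) => // A B mA mB.
rewrite /image_measure /= /pushforward muleC -product_measure1E//.
by congr (product_measure1 _ _ _); apply/seteqP; split => -[x y] [].
Qed.

(* The similarity taking the vertices [(0, 0)], [(1, 0)], [(0, 1)] of [T2] to [c2],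
   [(0, 0)], [(1, 0)]. *)
Definition half_lower (z : plane R) : plane R :=
  ((1 - z.1 + z.2) / 2, (1 - z.1 - z.2) / 2).

Definition half_upper (z : plane R) : plane R := swap (half_lower z).

Lemma measurable_half_lower : measurable_fun setT half_lower.
Proof.
apply: measurable_fun_pair => /=; apply: measurable_funM => //.
  apply: measurable_funD => //.
  by apply: measurable_funB.
by apply: measurable_funB => //;
  apply: measurable_funB.
Qed.

Lemma measurable_half_upper : measurable_fun setT half_upper.
Proof.
apply: (@measurableT_comp _ _ _ _ _ _ (swap : plane R -> plane R)) measurable_half_lower.
exact: measurable_swap.
Qed.

Lemma area_half_lower S : measurable S -> area (half_lower @^-1` S) = (2%:E * area S)%E.
Proof.
move=> mS.
(* [half_lower] factors as [phi], then [swap], then [psi]. The slope [2^-1] of [phi] produces the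
   factor 2, while [swap] and [psi] (slope -1) preserve area. *)
pose phi (z : plane R) : plane R := (z.1, 2^-1 * z.2 + (2^-1 - 2^-1 * z.1)).
pose psi (z : plane R) : plane R := (z.1, -1 * z.2 + (1 - z.1)).
have mh1 : measurable_fun setT
    (fun x : measurableTypeR R => 2^-1 - 2^-1 * x : measurableTypeR R).
  by apply: measurable_funB => //; apply: measurable_funM.
have mh2 : measurable_fun setT
    (fun x : measurableTypeR R => 1 - x : measurableTypeR R).
  by apply: measurable_funB.
have mpsi : measurable_fun setT psi.
  apply: measurable_fun_pair => //=; apply: measurable_funD => //.
    exact: measurable_funM.
  exact: (measurableT_comp mh2).
have mpsiS : measurable (psi @^-1` S) by rewrite -[X in measurable X]setTI; exact: mpsi.
have halfE : half_lower = (fun z => psi (swap (phi z))).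
  by apply/funext => -[u v]; rewrite /half_lower /psi /phi /=; congr pair; field.
rewrite halfE -[X in area X]/(phi @^-1` (swap @^-1` (psi @^-1` S))).
rewrite (@area_fiberwise_affine 2^-1 _ _ _ mh1)//; last first.
  by rewrite -[X in measurable X]setTI; exact: measurable_swap.
rewrite area_swap// (@area_fiberwise_affine (-1) _ _ _ mh2) ?oppr_eq0//.
by rewrite normrN1 invr1 mul1e gtr0_norm ?invr_gt0// invrK.
Qed.

Lemma area_half_upper S : measurable S -> area (half_upper @^-1` S) = (2%:E * area S)%E.
Proof.
move=> mS; rewrite -[in RHS]area_swap// -area_half_lower//.
by rewrite -[X in measurable X]setTI; exact: measurable_swap.
Qed.

Lemma measurable_below_diagonal : measurable [set z : plane R | z.2 <= z.1].
Proof. by rewrite -[X in measurable X]setTI; apply: measurable_fun_ler. Qed.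

Lemma measurable_above_diagonal : measurable [set z : plane R | z.1 <= z.2].
Proof. by rewrite -[X in measurable X]setTI; apply: measurable_fun_ler. Qed.

Lemma area_diagonal : area [set z : plane R | z.1 = z.2] = 0.
Proof.
rewrite /area /product_measure1 integral0_eq// => x _ /=.
rewrite (_ : xsection _ _ = [set x]) ?lebesgue_measure_set1//.
by apply/seteqP; split => y; rewrite /xsection/= inE/=.
Qed.

(** The two closed halves overlap only on the diagonal, which is a null set; keeping both closed
    makes them exact images of [T2]. *)
Lemma area_split_diagonal S : measurable S ->
  area S = (area (S `&` [set z | (z.2 <= z.1)%R]) +
            area (S `&` [set z | (z.1 <= z.2)%R]))%E.
Proof.
move=> mS; set L := [set z | _]; set U := [set z | _].
have mL : measurable L := measurable_below_diagonal.
have mU : measurable U := measurable_above_diagonal.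
have LU : L `&` U = [set z | z.1 = z.2].
  apply/seteqP; split => z; rewrite /L /U /=.
    by move=> [? ?]; apply/eqP; rewrite eq_le; apply/andP.
  by move=> ->.
have null : area (S `&` (L `&` U)) = 0.
  apply: (@subset_measure0 _ _ _ area_measure _ (L `&` U)).
  - by apply: measurableI => //; apply: measurableI.
  - exact: measurableI.
  - by move=> z [].
  - by rewrite LU; exact: area_diagonal.
have -> : area S = (area (S `\` L) + area (S `&` L))%E by exact: (measureDI area_measure).
rewrite addeC; congr (_ + _)%E.
transitivity (area (S `&` U `\` L) + area (S `&` U `&` L))%E.
  rewrite -setIA (setIC U) null adde0; congr (area _).
  apply/seteqP; split => z /= => [[Sz Lz]|[[]]//].
  by split => //; split => //; rewrite /U /=; move/negP: Lz; rewrite -ltNge => /ltW.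
by apply/esym; apply: (measureDI area_measure); first exact: measurableI.
Qed.

Lemma T2P (z : plane R) : T2 z <-> [/\ 0 <= z.1, 0 <= z.2 & z.1 + z.2 <= 1].
Proof.
case: z => x y; split => [[s [t [u [s0 t0 u0 stu [-> ->]]]]]|[/= x0 y0 xy1]].
  by rewrite /=; split; lra.
by exists (1 - x - y), x, y; rewrite /=; split; [lra|lra|lra|lra|congr pair; ring].
Qed.

Lemma measurable_T2 : measurable (T2 : set (plane R)).
Proof.
have -> : T2 = [set z : plane R | 0 <= z.1] `&` [set z : plane R | 0 <= z.2] `&`
    [set z : plane R | z.1 + z.2 <= 1].
  by apply/seteqP; split => z => [/T2P[]|[[? ?] ?]]; [|apply/T2P].
by do 2?apply: measurableI; rewrite -[X in measurable X]setTI;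
  apply: measurable_fun_ler => //; apply: measurable_funD.
Qed.

Lemma preimage_half_lower :
  half_lower @^-1` (T2 `&` [set z | z.2 <= z.1]) = T2.
Proof.
apply/seteqP; split => -[u v] /=; rewrite /half_lower /=.
  by move=> [/T2P/= []] ? ? ? ?; apply/T2P; split => /=; lra.
by move=> /T2P/= [] ? ? ?; split; [apply/T2P; split => /=|]; lra.
Qed.

Lemma preimage_half_upper :
  half_upper @^-1` (T2 `&` [set z | z.1 <= z.2]) = T2.
Proof.
rewrite -[RHS]preimage_half_lower; apply/seteqP; split => -[u v] /=;
  by move=> [/T2P[? ? ?] ?]; split => //; apply/T2P; split => //; rewrite addrC.
Qed.

(** Self-similarity of the area on [T2]: each half of [T2] pulls back to all of [T2], each
    similarity contributes a factor 2, and the halves add up. *)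
Lemma area_T2_halves S : measurable S ->
  (area (half_lower @^-1` S `&` T2) + area (half_upper @^-1` S `&` T2) =
   2%:E * area (S `&` T2))%E.
Proof.
move=> mS; have mST : measurable (S `&` T2) by apply: measurableI => //; exact: measurable_T2.
have mL := measurable_below_diagonal.
have mU := measurable_above_diagonal.
have -> : half_lower @^-1` S `&` T2 =
    half_lower @^-1` (S `&` T2 `&` [set z | z.2 <= z.1]).
  by rewrite -[T2 in LHS]preimage_half_lower -preimage_setI setIA.
have -> : half_upper @^-1` S `&` T2 =
    half_upper @^-1` (S `&` T2 `&` [set z | z.1 <= z.2]).
  by rewrite -[T2 in LHS]preimage_half_upper -preimage_setI setIA.
rewrite area_half_lower; last exact: measurableI.
rewrite area_half_upper; last exact: measurableI.
by rewrite -ge0_muleDr ?(measure_ge0 area_measure)// -area_split_diagonal.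
Qed.

End Area.

(** * The joint law of two independent uniform points *)

Lemma measure_unique_rectangles {d d'} {X : measurableType d} {Y : measurableType d'}
    {R : realType} (m1 m2 : {measure set (X * Y) -> \bar R}) :
  (m1 setT < +oo)%E ->
  (forall A B, measurable A -> measurable B -> m1 (A `*` B) = m2 (A `*` B)) ->
  forall S, measurable S -> m1 S = m2 S.
Proof.
move=> m1oo m12 S mS.
(* Rectangles form a generating class stable under intersection; as [m1] is finite, the constant
   sequence [setT] serves as the exhaustion. *)
pose G := [set C : set (X * Y) |
  exists A, measurable A /\ exists B, measurable B /\ C = A `*` B].
apply: (measure_unique G (fun=> setT)) => //.
- rewrite measurable_prod_measurableType //; congr (<<s _ >>).
  rewrite predeqE; split => [[A mA [B mB <-]]|[A [mA [B [mB ->]]]]].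
    by exists A; split => //; exists B.
  by exists A => //; exists B.
- move=> /= _ _ [A1 [mA1 [A2 [mA2 ->]]]] [B1 [mB1 [B2 [mB2 ->]]]].
  rewrite -setXI; exists (A1 `&` B1); split; first exact: measurableI.
  by exists (A2 `&` B2); split => //; exact: measurableI.
- by move=> _; exists setT; split => //; exists setT; split => //; rewrite setXTT.
- by rewrite bigcup_const.
- by move=> _ [A [mA [B [mB ->]]]]; exact: m12.
Qed.

Definition triangle_ratio {R : realType} (A : set (plane R)) : \bar R :=
  (area (A `&` T2) / area T2)%E.

Section TriangleRatio.
Context {R : realType}.
Implicit Types A : set (plane R).

Lemma triangle_ratio_ge0 A : (0 <= triangle_ratio A)%E.
Proof. by rewrite mule_ge0 ?inve_ge0 ?(measure_ge0 area_measure). Qed.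

Lemma triangle_ratio_halves A : measurable A ->
  (triangle_ratio (half_lower @^-1` A) + triangle_ratio (half_upper @^-1` A) =
   triangle_ratio A + triangle_ratio A)%E.
Proof.
move=> mA; have ge0 (B : set (plane R)) : (0 <= area B)%E := measure_ge0 area_measure B.
rewrite /triangle_ratio -[LHS](ge0_muleDl _ (ge0 _) (ge0 _)).
rewrite -[RHS](ge0_muleDl _ (ge0 _) (ge0 _)).
by rewrite area_T2_halves// mule_natl mule2n.
Qed.

Lemma triangle_ratioT : triangle_ratio T2 = triangle_ratio [set: plane R].
Proof. by rewrite /triangle_ratio setIid setTI. Qed.

End TriangleRatio.

Definition independent_uniform {R : realType}
    (J : probability (plane R * plane R)%type R) : Prop :=
  forall A B : set (plane R), measurable A -> measurable B ->
    J (A `*` B) = (triangle_ratio A * triangle_ratio B)%E.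

Section JointLaw.
Context {R : realType}.
Variable J : probability (plane R * plane R)%type R.
Hypothesis J_rectangle : independent_uniform J.

Lemma measurable_on_first (f : plane R -> plane R) : measurable_fun setT f ->
  measurable_fun setT (fun z : plane R * plane R => (f z.1, z.2)).
Proof.
move=> mf; apply: measurable_fun_pair => //=.
exact: (measurableT_comp mf measurable_fst).
Qed.

(** Self-similarity in the first point. Both sides are finite measures in [S], and on rectangles the
    identity reduces to [triangle_ratio_halves]. *)
Lemma J_halves S : measurable S ->
  (J S + J S =
   J ((fun z => (half_lower z.1, z.2)) @^-1` S) +
   J ((fun z => (half_upper z.1, z.2)) @^-1` S))%E.
Proof.
have mL := measurable_on_first _ measurable_half_lower.
have mU := measurable_on_first _ measurable_half_upper.
pose m1 : {measure set (plane R * plane R) -> \bar R} := measure_add J J.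
pose m2 : {measure set (plane R * plane R) -> \bar R} :=
  measure_add (image_measure J _ mL) (image_measure J _ mU).
have m1E B : m1 B = (J B + J B)%E by exact: measure_addE.
have m2E B : m2 B = (J ((fun z => (half_lower z.1, z.2)) @^-1` B) +
    J ((fun z => (half_upper z.1, z.2)) @^-1` B))%E by exact: measure_addE.
rewrite -m1E -m2E; move: S; apply: measure_unique_rectangles.
  by rewrite m1E probability_setT -EFinD ltry.
move=> A B mA mB; rewrite m1E m2E.
rewrite (_ : _ @^-1` (A `*` B) = (half_lower @^-1` A) `*` B)//.
rewrite [X in _ = (_ + J X)%E](_ : _ = (half_upper @^-1` A) `*` B)//.
have mlA : measurable (half_lower @^-1` A).
  by rewrite -[X in measurable X]setTI; exact: measurable_half_lower.
have muA : measurable (half_upper @^-1` A).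
  by rewrite -[X in measurable X]setTI; exact: measurable_half_upper.
rewrite (J_rectangle _ _ mA mB) (J_rectangle _ _ mlA mB) (J_rectangle _ _ muA mB).
rewrite -[LHS](ge0_muleDl _ (triangle_ratio_ge0 _) (triangle_ratio_ge0 _)).
rewrite -[RHS](ge0_muleDl _ (triangle_ratio_ge0 _) (triangle_ratio_ge0 _)).
exact: (congr1 (fun t => (t * triangle_ratio B)%E) (esym (triangle_ratio_halves _ mA))).
Qed.

Lemma J_exchange S : measurable S -> J S = J (swap @^-1` S).
Proof.
pose sw := (swap : plane R * plane R -> plane R * plane R).
have msw : measurable_fun setT sw by exact: measurable_swap.
move=> mS; rewrite -[RHS]/(image_measure J sw msw S).
apply: measure_unique_rectangles mS.
  by rewrite [X in (X < _)%E](probability_setT J) ltry.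
move=> A B mA mB; rewrite /image_measure /= /pushforward.
rewrite (_ : _ @^-1` _ = B `*` A); last by apply/seteqP; split => -[x y] [].
rewrite (J_rectangle _ _ mA mB) (J_rectangle _ _ mB mA); exact: muleC.
Qed.

Local Notation T22 := (T2 `*` T2 : set (plane R * plane R)).

Lemma measurable_T22 : measurable T22.
Proof. by apply: measurableX; exact: measurable_T2. Qed.

Lemma J_T22C : J (~` T22) = 0.
Proof.
(* [triangle_ratio] agrees on [T2] and on the whole plane, so [T22] has the mass of the whole space;
   the value of the area of [T2] does not enter. *)
have JT : J T22 = 1%E.
  rewrite -(probability_setT J) -setXTT (J_rectangle _ _ measurable_T2 measurable_T2).
  by rewrite (J_rectangle _ _ measurableT measurableT) triangle_ratioT.
by rewrite [LHS](probability_setC _ measurable_T22) [X in (_ - X)%E]JT subee.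
Qed.

(* Functions of the coordinates of [(u, v)] and [(u', v')]. *)
Definition bounded_measurable (g : R -> R -> R -> R -> R) : Prop :=
  measurable_fun setT (fun z : plane R * plane R => g z.1.1 z.1.2 z.2.1 z.2.2) /\
  exists M, forall x y, T2 x -> T2 y -> `|g x.1 x.2 y.1 y.2| <= M.

Definition mean (g : R -> R -> R -> R -> R) : R :=
  \int[J]_z g z.1.1 z.1.2 z.2.1 z.2.2.

(** The bound holds only on [T22], but the complement of [T22] is null, so it is enough to integrate
    a bounded function over a set of finite measure. *)
Lemma bounded_measurable_integrable g : bounded_measurable g ->
  J.-integrable setT (fun z => (g z.1.1 z.1.2 z.2.1 z.2.2)%:E).
Proof.
move=> [mg [M gM]]; have mT22C := measurableC measurable_T22; have J0 := J_T22C.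
have mg' : measurable_fun setT (fun z : plane R * plane R =>
  (g z.1.1 z.1.2 z.2.1 z.2.2)%:E) by exact/measurable_EFinP.
rewrite (negligible_integrable (N := ~` T22))//.
rewrite setTD setCK.
have mT22 := @measurable_T22; apply: measurable_bounded_integrable => //.
- by rewrite (le_lt_trans (probability_le1 _ mT22))// ltry.
- exact: measurable_funTS.
- exists M; split; first exact: num_real.
  by move=> x Mx [z1 z2] [/= T1 T2]; apply: (le_trans (gM _ _ T1 T2)); exact: ltW.
Qed.

Lemma mean_T22 g : bounded_measurable g ->
  mean g = \int[J]_(z in T22) g z.1.1 z.1.2 z.2.1 z.2.2.
Proof.
move=> bg; have mT22C := measurableC measurable_T22; have J0 := J_T22C.
rewrite /mean /Rintegral (@negligible_integral _ _ _ _ _ (~` T22))//.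
  by rewrite setTD setCK.
exact: bounded_measurable_integrable.
Qed.

End JointLaw.

(** * Calculus of means: linearity, monotonicity, symmetries, self-similarity *)

Section Mean.
Context {R : realType}.
Variable J : probability (plane R * plane R)%type R.
Hypothesis J_rectangle : independent_uniform J.

Local Notation mean := (mean J).
Implicit Types f g : R -> R -> R -> R -> R.

Let integrable g : bounded_measurable g ->
  J.-integrable setT (fun z => (g z.1.1 z.1.2 z.2.1 z.2.2)%:E).
Proof. exact: bounded_measurable_integrable. Qed.

Lemma EFin_mean g : bounded_measurable g ->
  (\int[J]_z (g z.1.1 z.1.2 z.2.1 z.2.2)%:E)%E = (mean g)%:E.
Proof. by move=> bg; rewrite fineK//; apply: integrable_fin_num => //; exact: integrable. Qed.

Lemma mean_eq f g : (forall u v u' v', f u v u' v' = g u v u' v') -> mean f = mean g.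
Proof. by move=> fg; apply: eq_Rintegral => z _; exact: fg. Qed.

Lemma mean_cst c : mean (fun _ _ _ _ => c) = c.
Proof. by rewrite /mean Rintegral_cst// [X in fine X](probability_setT J) mulr1. Qed.

Lemma meanD f g : bounded_measurable f -> bounded_measurable g ->
  mean (fun u v u' v' => f u v u' v' + g u v u' v') = mean f + mean g.
Proof. by move=> bf bg; rewrite /mean RintegralD//; exact: integrable. Qed.

Lemma meanB f g : bounded_measurable f -> bounded_measurable g ->
  mean (fun u v u' v' => f u v u' v' - g u v u' v') = mean f - mean g.
Proof. by move=> bf bg; rewrite /mean RintegralB//; exact: integrable. Qed.

Lemma meanZ c f : bounded_measurable f ->
  mean (fun u v u' v' => c * f u v u' v') = c * mean f.
Proof. by move=> bf; rewrite /mean RintegralZl//; exact: integrable. Qed.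

Lemma bounded_measurable_cst c : bounded_measurable (fun _ _ _ _ : R => c).
Proof. by split; [exact: measurable_cst|exists `|c|]. Qed.

Let le1 (x y : R) : 0 <= x -> 0 <= y -> x + y <= 1 -> `|x| <= 1.
Proof. by move=> *; rewrite ger0_norm//; lra. Qed.

Lemma bounded_measurable_u : bounded_measurable (fun u _ _ _ : R => u).
Proof.
split; first exact: (measurableT_comp measurable_fst measurable_fst).
by exists 1 => x y /T2P[x1 x2 x12] _; exact: (le1 _ _ x1 x2).
Qed.

Lemma bounded_measurable_v : bounded_measurable (fun _ v _ _ : R => v).
Proof.
split; first exact: (measurableT_comp measurable_snd measurable_fst).
by exists 1 => x y /T2P[x1 x2 x12] _; apply: (le1 _ _ x2 x1); rewrite addrC.
Qed.

Lemma bounded_measurable_u' : bounded_measurable (fun _ _ u' _ : R => u').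
Proof.
split; first exact: (measurableT_comp measurable_fst measurable_snd).
by exists 1 => x y _ /T2P[x1 x2 x12]; exact: (le1 _ _ x1 x2).
Qed.

Lemma bounded_measurable_v' : bounded_measurable (fun _ _ _ v' : R => v').
Proof.
split; first exact: (measurableT_comp measurable_snd measurable_snd).
by exists 1 => x y _ /T2P[x1 x2 x12]; apply: (le1 _ _ x2 x1); rewrite addrC.
Qed.

Lemma bounded_measurableD f g : bounded_measurable f -> bounded_measurable g ->
  bounded_measurable (fun u v u' v' => f u v u' v' + g u v u' v').
Proof.
move=> [mf [M fM]] [mg [N gN]]; split; first exact: measurable_funD.
by exists (M + N) => x y Tx Ty; rewrite (le_trans (ler_normD _ _))// lerD ?fM ?gN.
Qed.

Lemma bounded_measurableM f g : bounded_measurable f -> bounded_measurable g ->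
  bounded_measurable (fun u v u' v' => f u v u' v' * g u v u' v').
Proof.
move=> [mf [M fM]] [mg [N gN]]; split; first exact: measurable_funM.
by exists (M * N) => x y Tx Ty; rewrite normrM ler_pM ?fM ?gN.
Qed.

Lemma bounded_measurableN f : bounded_measurable f ->
  bounded_measurable (fun u v u' v' => - f u v u' v').
Proof.
move=> [mf [M fM]]; split; first exact: measurable_funN.
by exists M => x y Tx Ty; rewrite normrN fM.
Qed.

Lemma bounded_measurableX f n : bounded_measurable f ->
  bounded_measurable (fun u v u' v' => f u v u' v' ^+ n).
Proof.
move=> [mf [M fM]]; split; first exact: measurable_funX.
by exists (M ^+ n) => x y Tx Ty; rewrite normrX lerXn2r ?nnegrE ?fM// (le_trans _ (fM _ _ Tx Ty)).
Qed.

Lemma bounded_measurable_norm f : bounded_measurable f ->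
  bounded_measurable (fun u v u' v' => `|f u v u' v'|).
Proof.
move=> [mf [M fM]]; split; first exact: (measurableT_comp (@normr_measurable R setT)).
by exists M => x y Tx Ty; rewrite normr_id fM.
Qed.

Lemma bounded_measurable_sqrt f : bounded_measurable f ->
  bounded_measurable (fun u v u' v' => Num.sqrt (f u v u' v')).
Proof.
move=> [mf [M fM]]; split.
  apply: (measurableT_comp _ mf).
  by apply: continuous_measurable_fun; exact: sqrt_continuous.
exists (Num.sqrt M) => x y Tx Ty; rewrite ger0_norm ?sqrtr_ge0//.
by rewrite ler_wsqrtr// (le_trans (ler_norm _))// fM.
Qed.

Lemma mean_le f g : bounded_measurable f -> bounded_measurable g ->
  (forall u v u' v', 0 <= u -> 0 <= v -> u + v <= 1 ->
     0 <= u' -> 0 <= v' -> u' + v' <= 1 -> f u v u' v' <= g u v u' v') ->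
  mean f <= mean g.
Proof.
move=> bf bg fg; rewrite !(mean_T22 _ J_rectangle)//.
have mT22 := @measurable_T22 R.
apply: le_Rintegral => //.
- exact: (integrableS measurableT mT22 _ (integrable _ bf)).
- exact: (integrableS measurableT mT22 _ (integrable _ bg)).
- by move=> [x y] [/= /T2P[? ? ?] /T2P[? ? ?]]; exact: fg.
Qed.

Let mean_pushforward (phi : plane R * plane R -> plane R * plane R) g :
  bounded_measurable g -> forall mphi : measurable_fun setT phi,
  bounded_measurable (fun u v u' v' => let z := phi ((u, v), (u', v')) in
     g z.1.1 z.1.2 z.2.1 z.2.2) ->
  (image_measure J phi mphi).-integrable setT (fun z => (g z.1.1 z.1.2 z.2.1 z.2.2)%:E) /\
  (\int[image_measure J phi mphi]_z (g z.1.1 z.1.2 z.2.1 z.2.2)%:E)%E =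
  (mean (fun u v u' v' => let z := phi ((u, v), (u', v')) in
     g z.1.1 z.1.2 z.2.1 z.2.2))%:E.
Proof.
move=> bg mphi bgphi.
have mg : measurable_fun setT (fun z : plane R * plane R =>
  (g z.1.1 z.1.2 z.2.1 z.2.2)%:E) by apply/measurable_EFinP; exact: bg.1.
have E z : (z.1.1, z.1.2, (z.2.1, z.2.2)) = z :> plane R * plane R.
  by case: z => -[? ?] [].
have int_gphi : J.-integrable (phi @^-1` setT)
    ((fun z => (g z.1.1 z.1.2 z.2.1 z.2.2)%:E) \o phi).
  rewrite preimage_setT; apply: eq_integrable (integrable _ bgphi) => // z _ /=.
  by rewrite E.
split; first exact: integrable_pushforward.
rewrite [LHS]integral_pushforward// preimage_setT -EFin_mean//.
by apply: eq_integral => z _ /=; rewrite E.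
Qed.

Lemma T2_half_lower (x : plane R) : T2 x -> T2 (half_lower x).
Proof. by move=> /T2P[? ? ?]; apply/T2P; rewrite /half_lower /=; split; lra. Qed.

Lemma T2_half_upper (x : plane R) : T2 x -> T2 (half_upper x).
Proof. by move=> /T2P[? ? ?]; apply/T2P; rewrite /half_upper /=; split; lra. Qed.

Lemma bounded_measurable_half_lower g : bounded_measurable g ->
  bounded_measurable (fun u v => g ((1 - u + v) / 2) ((1 - u - v) / 2)).
Proof.
move=> [mg [M gM]]; split.
  exact: (measurableT_comp mg (measurable_on_first _ measurable_half_lower)).
by exists M => x y Tx Ty; exact: gM (T2_half_lower _ Tx) Ty.
Qed.

Lemma bounded_measurable_half_upper g : bounded_measurable g ->
  bounded_measurable (fun u v => g ((1 - u - v) / 2) ((1 - u + v) / 2)).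
Proof.
move=> [mg [M gM]]; split.
  exact: (measurableT_comp mg (measurable_on_first _ measurable_half_upper)).
by exists M => x y Tx Ty; exact: gM (T2_half_upper _ Tx) Ty.
Qed.

Lemma bounded_measurable_exchange g : bounded_measurable g ->
  bounded_measurable (fun u v u' v' => g u' v' u v).
Proof.
move=> [mg [M gM]]; split.
  exact: (measurableT_comp mg (@measurable_swap _ _ _ _)).
by exists M => x y Tx Ty; exact: gM Ty Tx.
Qed.

(** Integrated form of [J_halves]: twice [J] and the sum of its images under the two similarities
    are the same measure. *)
Lemma mean_halves g : bounded_measurable g ->
  2 * mean g = mean (fun u v => g ((1 - u + v) / 2) ((1 - u - v) / 2)) +
               mean (fun u v => g ((1 - u - v) / 2) ((1 - u + v) / 2)).
Proof.
move=> bg.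
have [intL EL] := mean_pushforward _ _ bg
  (measurable_on_first _ measurable_half_lower) (bounded_measurable_half_lower _ bg).
have [intU EU] := mean_pushforward _ _ bg
  (measurable_on_first _ measurable_half_upper) (bounded_measurable_half_upper _ bg).
have mg : measurable_fun setT (fun z : plane R * plane R =>
  (g z.1.1 z.1.2 z.2.1 z.2.2)%:E) by apply/measurable_EFinP; exact: bg.1.
apply: EFin_inj; rewrite mulr_natl mulr2n !EFinD -{1 2}EFin_mean//.
rewrite -integral_measure_add//; [|exact: integrable..].
rewrite -EL -EU -integral_measure_add//.
apply: eq_measure_integral => S mS _; rewrite [LHS]measure_addE [RHS]measure_addE.
exact: J_halves.
Qed.

Lemma mean_exchange g : bounded_measurable g ->
  mean (fun u v u' v' => g u' v' u v) = mean g.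
Proof.
move=> bg; have msw := @measurable_swap _ _ (plane R) (plane R).
have [intS ES] := mean_pushforward _ _ bg msw (bounded_measurable_exchange _ bg).
apply: EFin_inj; rewrite -[LHS]ES -EFin_mean//.
by apply: eq_measure_integral => S mS _; apply/esym/J_exchange.
Qed.

Lemma bounded_measurable_swap g : bounded_measurable g ->
  bounded_measurable (fun u v => g v u).
Proof.
move=> [mg [M gM]]; split.
  exact: (measurableT_comp mg (measurable_on_first _ (@measurable_swap _ _ _ _))).
exists M => x y /T2P[x1 x2 x12] Ty; apply: (gM (x.2, x.1)) => //.
by apply/T2P; split; rewrite //= addrC.
Qed.

(* [half_upper] is [half_lower] followed by [swap]. *)
Lemma mean_swap g : bounded_measurable g -> mean (fun u v => g v u) = mean g.
Proof.
move=> bg; have bg' := bounded_measurable_swap _ bg; have := mean_halves _ bg; have := mean_halves _ bg' => /= E1 E2.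
have {E1 E2}: 2 * mean (fun u v => g v u) = 2 * mean g by rewrite E1 E2 addrC.
by apply: mulfI; rewrite pnatr_eq0.
Qed.

Lemma mean_halves_snd g : bounded_measurable g ->
  2 * mean g =
    mean (fun u v u' v' => g u v ((1 - u' + v') / 2) ((1 - u' - v') / 2)) +
    mean (fun u v u' v' => g u v ((1 - u' - v') / 2) ((1 - u' + v') / 2)).
Proof.
move=> bg; have bx := bounded_measurable_exchange _ bg.
rewrite -(mean_exchange _ bg) (mean_halves _ bx); congr (_ + _).
  exact: esym (mean_exchange _ (bounded_measurable_half_lower _ bx)).
exact: esym (mean_exchange _ (bounded_measurable_half_upper _ bx)).
Qed.

Lemma mean_swap_snd g : bounded_measurable g ->
  mean (fun u v u' v' => g u v v' u') = mean g.
Proof.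
move=> bg; have bx := bounded_measurable_exchange _ bg.
rewrite -(mean_exchange _ bg) -(mean_swap _ bx).
exact: mean_exchange _ (bounded_measurable_swap _ bx).
Qed.

Lemma mean_eq_T2 f g : bounded_measurable f -> bounded_measurable g ->
  (forall u v u' v', 0 <= u -> 0 <= v -> u + v <= 1 ->
     0 <= u' -> 0 <= v' -> u' + v' <= 1 -> f u v u' v' = g u v u' v') ->
  mean f = mean g.
Proof.
by move=> bf bg fg; apply/eqP; rewrite eq_le !mean_le// => *; rewrite fg.
Qed.

(** Turns self-similarity into equations between moments: a polynomial may be replaced by the
    average [h] of its two pullbacks. *)
Lemma mean_average g h : bounded_measurable g ->
  (forall u v u' v', g ((1 - u + v) / 2) ((1 - u - v) / 2) u' v' +
    g ((1 - u - v) / 2) ((1 - u + v) / 2) u' v' = 2 * h u v u' v') ->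
  bounded_measurable h -> mean g = mean h.
Proof.
move=> bg gh bh; apply: (@mulfI _ 2); first by rewrite pnatr_eq0.
rewrite mean_halves// -meanZ// -meanD; first exact: mean_eq.
  exact: bounded_measurable_half_lower.
exact: bounded_measurable_half_upper.
Qed.

(** One splitting mixes the coordinates; a second one separates them again, because after a
    similarity the sum of the coordinates is [1 - u] and their difference is [v] or [- v]. The
    remaining [v] becomes [u] by [mean_swap]. *)
Lemma mean_quarters (phi : R -> R -> R -> R) :
  bounded_measurable (fun u _ => phi u) ->
  4 * mean (fun u _ => phi u) =
    mean (fun u _ => phi ((1 - u) / 2)) + mean (fun u _ => phi ((1 + u) / 2)) +
    2 * mean (fun u _ => phi (u / 2)).
Proof.
move=> bg.
have bl := bounded_measurable_half_lower _ bg.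
have bu := bounded_measurable_half_upper _ bg.
have bll := bounded_measurable_half_lower _ bl.
have blu := bounded_measurable_half_upper _ bl.
have E0 := mean_halves _ bg.
have E1 : 2 * mean (fun u v => phi ((1 - u + v) / 2)) =
    mean (fun u _ => phi ((1 - u) / 2)) + mean (fun u _ => phi ((1 + u) / 2)).
  rewrite (mean_halves _ bl) -(mean_swap _ bll) -(mean_swap _ blu).
  by congr (_ + _); apply: mean_eq => u v u' v'; congr (phi _ _ _); field.
have E2 : 2 * mean (fun u v => phi ((1 - u - v) / 2)) = 2 * mean (fun u _ => phi (u / 2)).
  rewrite (mean_halves _ bu) mulr_natl mulr2n.
  by congr (_ + _); apply: mean_eq => u v u' v'; congr (phi _ _ _); field.
move: E0 E1 E2 => /= E0 E1 E2; lra.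
Qed.

Lemma mean_quarters_snd (phi : R -> R -> R -> R) :
  bounded_measurable (fun u v u' _ => phi u v u') ->
  bounded_measurable (fun u v u' _ => phi u v ((1 - u') / 2)) ->
  bounded_measurable (fun u v u' _ => phi u v ((1 + u') / 2)) ->
  bounded_measurable (fun u v u' _ => phi u v (u' / 2)) ->
  4 * mean (fun u v u' _ => phi u v u') =
    mean (fun u v u' _ => phi u v ((1 - u') / 2)) +
    mean (fun u v u' _ => phi u v ((1 + u') / 2)) +
    2 * mean (fun u v u' _ => phi u v (u' / 2)).
Proof.
move=> bg b1 b2 b3; rewrite -(mean_exchange _ b1) -(mean_exchange _ b2).
rewrite -(mean_exchange _ b3) -(mean_exchange _ bg).
exact: (mean_quarters (fun u u' v' => phi u' v' u) (bounded_measurable_exchange _ bg)).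
Qed.

End Mean.

Ltac bounded_measurable := repeat first
  [ exact: bounded_measurable_cst
  | exact: bounded_measurable_u | exact: bounded_measurable_v
  | exact: bounded_measurable_u' | exact: bounded_measurable_v'
  | apply: bounded_measurableD | apply: bounded_measurableN
  | apply: bounded_measurableM | apply: bounded_measurableX
  | apply: bounded_measurable_norm | apply: bounded_measurable_sqrt ].

(** * Low-order moments from self-similarity *)

Section Moments.
Context {R : realType}.
Variable J : probability (plane R * plane R)%type R.
Hypothesis J_rectangle : independent_uniform J.

Local Notation mean := (mean J).

Let B f g := @meanB R J J_rectangle f g.
Let D f g := @meanD R J J_rectangle f g.
Let Z c f := @meanZ R J J_rectangle c f.
Let C c := @mean_cst R J c.

Ltac expand := rewrite ?(B, D, Z, C); try by bounded_measurable.
Ltac average := apply: (mean_average _ J_rectangle) =>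
  [|? ? ? ?|]; [by bounded_measurable | by field | by bounded_measurable].
Ltac swap_coordinates g :=
  apply: (mean_swap _ J_rectangle g); by bounded_measurable.

Lemma mean_v : mean (fun _ v _ _ => v) = mean (fun u _ _ _ => u).
Proof. swap_coordinates (fun u _ _ _ : R => u). Qed.

Lemma mean_vv : mean (fun _ v _ _ => v * v) = mean (fun u _ _ _ => u * u).
Proof. swap_coordinates (fun u _ _ _ : R => u * u). Qed.

Lemma mean_uuv : mean (fun u v _ _ => u * u * v) = mean (fun u v _ _ => u * v * v).
Proof.
transitivity (mean (fun u v _ _ => v * v * u)); last by apply: mean_eq => *; ring.
apply/esym; swap_coordinates (fun u v _ _ : R => u * u * v).
Qed.

(** Pattern for the moments below: averaging over the halves does not raise the degree, so each
    moment solves a linear equation in itself and moments already known. *)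
Lemma mean_u : mean (fun u _ _ _ => u) = 1 / 3.
Proof.
have : mean (fun _ v _ _ => v) = mean (fun u _ _ _ => 1 / 2 - 1 / 2 * u) by average.
by expand; rewrite mean_v => ?; lra.
Qed.

Lemma mean_uu : mean (fun u _ _ _ => u * u) = 1 / 6.
Proof.
have : mean (fun u _ _ _ => u * u) =
  mean (fun u v _ _ => 1 / 4 - 1 / 2 * u + 1 / 4 * (u * u) + 1 / 4 * (v * v)) by average.
by expand; rewrite mean_vv mean_u => ?; lra.
Qed.

Lemma mean_uv : mean (fun u v _ _ => u * v) = 1 / 12.
Proof.
have : mean (fun u v _ _ => u * v) =
  mean (fun u v _ _ => 1 / 4 - 1 / 2 * u + 1 / 4 * (u * u) - 1 / 4 * (v * v)) by average.
by expand; rewrite mean_vv mean_uu mean_u => ?; lra.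
Qed.

(** In degree three the equations for [u * u * u] and [u * v * v] are coupled and are solved
    together. *)
Lemma mean_uvv : mean (fun u v _ _ => u * v * v) = 1 / 30.
Proof.
have : mean (fun u _ _ _ => u * u * u) =
  mean (fun u v _ _ => 1 / 8 - 3 / 8 * u + 3 / 8 * (u * u) - 1 / 8 * (u * u * u)
    + 3 / 8 * (v * v) - 3 / 8 * (u * v * v)) by average.
have : mean (fun u v _ _ => u * v * v) =
  mean (fun u v _ _ => 1 / 8 - 3 / 8 * u + 3 / 8 * (u * u) - 1 / 8 * (u * u * u)
    - 1 / 8 * (v * v) + 1 / 8 * (u * v * v)) by average.
by expand; rewrite mean_vv mean_uu mean_u => ? ?; lra.
Qed.

Lemma mean_v_snd : mean (fun _ _ _ v' => v') = 1 / 3.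
Proof.
rewrite -mean_u -mean_v.
by apply: (mean_exchange _ J_rectangle (fun _ v _ _ => v)); bounded_measurable.
Qed.

Lemma mean_u_snd : mean (fun _ _ u' _ => u') = 1 / 3.
Proof.
rewrite -mean_u.
by apply: (mean_exchange _ J_rectangle (fun u _ _ _ => u)); bounded_measurable.
Qed.

(* Both coordinates are distributed as [(1 - u) / 2], [(1 + u) / 2], [u / 2] with
   weights 1/4, 1/4, 1/2, which closes up into a linear system for this mean and that of
   [`|1 - u - u'|]. *)
Lemma mean_distance_u : mean (fun u _ u' _ => `|u - u'|) = 4 / 15.
Proof.
pose dd := mean (fun u _ u' _ => `|u - u'|).
pose mm := mean (fun u _ u' _ => `|1 - u - u'|).
pose a := mean (fun u _ u' _ => `|(1 - u) / 2 - u'|).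
pose b := mean (fun u _ u' _ => `|(1 + u) / 2 - u'|).
pose c := mean (fun u _ u' _ => `|u / 2 - u'|).
pose e := mean (fun u _ u' _ => `|1 - u / 2 - u'|).
have half2 : `|2^-1 : R| = 1 / 2 by rewrite ger0_norm; [lra|rewrite invr_ge0].
have Ed : 4 * dd = a + b + 2 * c.
  by apply: (mean_quarters _ J_rectangle (fun u u' _ => `|u - u'|)); bounded_measurable.
have Em : 4 * mm = a + b + 2 * e.
  rewrite (mean_quarters _ J_rectangle (fun u u' _ => `|1 - u - u'|)); last by bounded_measurable.
  rewrite (addrC a); congr (_ + _ + _); apply: mean_eq => u v u' v'; congr `|_|; by field.
(* Now the second point is split. In each branch the argument is either half that of [dd] or [mm] up
   to sign, or of constant sign on the triangles, where the absolute value opens to an affine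
   function. *)
have Ea : 4 * a = 1 / 2 * dd + 1 / 3 + mm.
  rewrite (mean_quarters_snd _ J_rectangle (fun u _ u' => `|(1 - u) / 2 - u'|)); try by bounded_measurable.
  rewrite (_ : mm = 2 * (1 / 2 * mm)); last by field.
  congr (_ + _ + 2 * _).
  - rewrite -Z; last by bounded_measurable.
    apply: mean_eq => u v u' v'; rewrite -half2 -normrM -normrN; congr `|_|; by field.
  - transitivity (mean (fun u v u' v' => 1 / 2 * u + 1 / 2 * u')).
      apply: (mean_eq_T2 _ J_rectangle) => [||u v u' v' *]; try by bounded_measurable.
      by rewrite ler0_norm; lra.
    by expand; rewrite mean_u mean_u_snd; lra.
  - rewrite -Z; last by bounded_measurable.
    apply: mean_eq => u v u' v'; rewrite -half2 -normrM; congr `|_|; by field.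
have Eb : 4 * b = 1 / 3 + 1 / 2 * dd + 2 * (1 / 2).
  rewrite (mean_quarters_snd _ J_rectangle (fun u _ u' => `|(1 + u) / 2 - u'|)); try by bounded_measurable.
  congr (_ + _ + 2 * _).
  - transitivity (mean (fun u v u' v' => 1 / 2 * u + 1 / 2 * u')).
      apply: (mean_eq_T2 _ J_rectangle) => [||u v u' v' *]; try by bounded_measurable.
      by rewrite ger0_norm; lra.
    by expand; rewrite mean_u mean_u_snd; lra.
  - rewrite -Z; last by bounded_measurable.
    apply: mean_eq => u v u' v'; rewrite -half2 -normrM; congr `|_|; by field.
  - transitivity (mean (fun u v u' v' => 1 / 2 + 1 / 2 * u - 1 / 2 * u')).
      apply: (mean_eq_T2 _ J_rectangle) => [||u v u' v' *]; try by bounded_measurable.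
      by rewrite ger0_norm; lra.
    by expand; rewrite mean_u mean_u_snd; lra.
have Ec : 4 * c = 1 / 2 * mm + 1 / 2 + dd.
  rewrite (mean_quarters_snd _ J_rectangle (fun u _ u' => `|u / 2 - u'|)); try by bounded_measurable.
  rewrite (_ : dd = 2 * (1 / 2 * dd)); last by field.
  congr (_ + _ + 2 * _).
  - rewrite -Z; last by bounded_measurable.
    apply: mean_eq => u v u' v'; rewrite -half2 -normrM -normrN; congr `|_|; by field.
  - transitivity (mean (fun u v u' v' => 1 / 2 - 1 / 2 * u + 1 / 2 * u')).
      apply: (mean_eq_T2 _ J_rectangle) => [||u v u' v' *]; try by bounded_measurable.
      by rewrite ler0_norm; lra.
    by expand; rewrite mean_u mean_u_snd; lra.
  - rewrite -Z; last by bounded_measurable.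
    apply: mean_eq => u v u' v'; rewrite -half2 -normrM; congr `|_|; by field.
have Ee : 4 * e = 1 / 2 + 1 / 2 * mm + 2 * (2 / 3).
  rewrite (mean_quarters_snd _ J_rectangle (fun u _ u' => `|1 - u / 2 - u'|)); try by bounded_measurable.
  congr (_ + _ + 2 * _).
  - transitivity (mean (fun u v u' v' => 1 / 2 - 1 / 2 * u + 1 / 2 * u')).
      apply: (mean_eq_T2 _ J_rectangle) => [||u v u' v' *]; try by bounded_measurable.
      by rewrite ger0_norm; lra.
    by expand; rewrite mean_u mean_u_snd; lra.
  - rewrite -Z; last by bounded_measurable.
    apply: mean_eq => u v u' v'; rewrite -half2 -normrM; congr `|_|; by field.
  - transitivity (mean (fun u v u' v' => 1 - 1 / 2 * u - 1 / 2 * u')).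
      apply: (mean_eq_T2 _ J_rectangle) => [||u v u' v' *]; try by bounded_measurable.
      by rewrite ger0_norm; lra.
    by expand; rewrite mean_u mean_u_snd; lra.
(* Six linear equations in [dd], [mm], [a], [b], [c], [e]. *)
rewrite -/dd; lra.
Qed.

End Moments.

(** * Elementary inequalities for powers and square roots *)

Section PowerInequalities.
Context {R : realType}.
Implicit Types a b m r s t : R.

(* Induction of step 2 from the exponents 2 and 3; the step is Chebyshev's
   [a ^+ n.+2 + b ^+ n.+2 >= (a ^+ 2 + b ^+ 2) / 2 * (a ^+ n + b ^+ n)]. *)
Lemma power_mean_ge_quadratic a b m n : 0 <= a -> 0 <= b -> 0 <= m ->
  a ^+ 2 + b ^+ 2 = 2 * m ^+ 2 -> 2 * m ^+ n.+2 <= a ^+ n.+2 + b ^+ n.+2.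
Proof.
move=> a0 b0 m0 abm.
suff [] : 2 * m ^+ n.+2 <= a ^+ n.+2 + b ^+ n.+2 /\
  2 * m ^+ n.+3 <= a ^+ n.+3 + b ^+ n.+3 by [].
elim: n => [|n [IH1 IH2]].
  split; first by rewrite abm.
  (* The tangent of [t ^ (3 / 2)] at [t = m ^ 2], taken at [t = x ^ 2] and doubled. *)
  have tangent x : 0 <= x -> 3 * m * x ^+ 2 - m ^+ 3 <= 2 * x ^+ 3.
    move=> x0; rewrite -subr_ge0.
    rewrite (_ : _ - _ = (x - m) ^+ 2 * (2 * x + m)); last by ring.
    by rewrite mulr_ge0 ?sqr_ge0// addr_ge0// mulr_ge0.
  have := tangent a a0; have := tangent b b0.
  have : 3 * m * (a ^+ 2 + b ^+ 2) = 6 * m ^+ 3 by rewrite abm; ring.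
  by move=> H1 H2 H3; nra.
split=> //.
have cheb : 0 <= (a ^+ n.+2 - b ^+ n.+2) * (a ^+ 2 - b ^+ 2).
  have [ab|/ltW ba] := leP a b.
    by rewrite -mulrNN mulr_ge0// opprB subr_ge0 lerXn2r.
  by rewrite mulr_ge0// subr_ge0 lerXn2r.
have E x : x ^+ n.+4 = x ^+ n.+2 * x ^+ 2 by rewrite -exprD addn2.
rewrite !E.
have m2 := sqr_ge0 m; have : 0 <= m ^+ 2 * (a ^+ n.+2 + b ^+ n.+2 - 2 * m ^+ n.+2).
  by rewrite mulr_ge0// subr_ge0.
move: abm cheb IH1 m2; move: (a ^+ n.+2) (b ^+ n.+2) (m ^+ n.+2) (a ^+ 2) (b ^+ 2) (m ^+ 2).
move=> x y z p q w pq; have -> : w = (p + q) / 2 by rewrite pq; field.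
by move=> H1 H2 H3 H4; nra.
Qed.

(** Both [r] and [s] are at most [m], so raising the exponent by one multiplies the left side by at
    most [m]. *)
Lemma power_superadditive r s m n : 0 <= r -> 0 <= s -> 0 <= m ->
  m ^+ 2 = r ^+ 2 + s ^+ 2 -> r ^+ n.+2 + s ^+ n.+2 <= m ^+ n.+2.
Proof.
move=> r0 s0 m0 E.
have rm : r <= m by rewrite -(ler_pXn2r (n := 2))// E lerDl sqr_ge0.
have sm : s <= m by rewrite -(ler_pXn2r (n := 2))// E lerDr sqr_ge0.
elim: n => [|n IH]; first by rewrite E.
rewrite !(exprS _ n.+2) (le_trans (y := m * (r ^+ n.+2 + s ^+ n.+2)))//.
  by rewrite mulrDr lerD// ler_wpM2r// exprn_ge0.
by rewrite ler_wpM2l.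
Qed.

Lemma bernoulli t n : 0 <= t -> 1 + n%:R * (t - 1) <= t ^+ n.
Proof.
move=> t0; elim: n => [|n IH]; first by rewrite mul0r addr0 expr0.
rewrite exprS -natr1; apply: (le_trans _ (ler_wpM2l t0 IH)).
(* This is exactly the slack in the induction step. *)
have : 0 <= n%:R * (t - 1) ^+ 2 by rewrite mulr_ge0 ?sqr_ge0.
by move: (n%:R) => c; nra.
Qed.

Lemma le_sqrt a b : a ^+ 2 <= b -> a <= Num.sqrt b.
Proof.
by move=> ab; rewrite (le_trans (ler_norm a))// -sqrtr_sqr ler_wsqrtr.
Qed.

(* With [s = u + v], [u ^+ 2 + v ^+ 2 = s * (s - 2 * u * v / s)]; the tangent of [1 / s] at
   [s = 4 / 5] bounds the second factor by [q], and the bound is AM-GM for [s] and [q]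
   with weights [5 / 6] and [6 / 5]. *)
Lemma hypotenuse_le (u v : R) : 0 <= u -> 0 <= v -> u + v <= 1 ->
  Num.sqrt (u ^+ 2 + v ^+ 2) <=
  61 / 60 * u + 61 / 60 * v - 3 * (u * v) + 15 / 8 * (u * u * v) + 15 / 8 * (u * v * v).
Proof.
move=> u0 v0 uv1; set p := (X in _ <= X).
pose s := u + v; pose q := s - 5 * (u * v) + 25 / 8 * (u * v * s).
have pE : p = (5 / 6 * s + 6 / 5 * q) / 2 by rewrite /p /q /s; field.
have uv0 : 0 <= u * v by rewrite mulr_ge0.
have s0 : 0 <= s by rewrite addr_ge0.
(* From [4 * (u * v) <= s * s <= s] follows [q >= - s / 4], which the term [5 / 6 * s] outweighs.
   Nonnegativity of [p] reduces the claim to a comparison of squares. *)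
have p0 : 0 <= p.
  have : u * v * s >= 0 by rewrite mulr_ge0.
  have : 4 * (u * v) <= s * s by have := sqr_ge0 (u - v); rewrite /s; nra.
  have : s * s <= s by rewrite -[leRHS]mulr1 ler_wpM2l.
  rewrite pE /q; lra.
rewrite -[leRHS]ger0_norm// -sqrtr_sqr ler_wsqrtr//.
have sq : u ^+ 2 + v ^+ 2 <= s * q.
  rewrite -subr_ge0 (_ : _ - _ = 2 * (u * v) * (1 - 5 / 4 * s) ^+ 2); last first.
    by rewrite /q /s; field.
  by rewrite mulr_ge0 ?sqr_ge0// mulr_ge0.
rewrite (le_trans sq)// pE -subr_ge0.
rewrite (_ : _ - _ = ((5 / 6 * s - 6 / 5 * q) / 2) ^+ 2); last by field.
exact: sqr_ge0.
Qed.

End PowerInequalities.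

(** * Comparison of the two mean distances *)

Section Comparison.
Context {R : realType}.
Variable J : probability (plane R * plane R)%type R.
Hypothesis J_rectangle : independent_uniform J.

Local Notation mean := (mean J).

Let B f g := @meanB R J J_rectangle f g.
Let D f g := @meanD R J J_rectangle f g.
Let Z c f := @meanZ R J J_rectangle c f.
Let C c := @mean_cst R J c.

Ltac expand := rewrite ?(B, D, Z, C); try by bounded_measurable.

Variable k : nat.

Let distance := mean (fun u v u' v' => Num.sqrt ((u - u') ^+ 2 + (v - v') ^+ 2) ^+ k).
(** The second point enters with [v'] negated, as happens when the two points fall into different
    halves. *)
Let distance_across := mean (fun u v u' v' => Num.sqrt ((u - u') ^+ 2 + (v + v') ^+ 2) ^+ k).
Let distance_c2 := mean (fun u v _ _ => Num.sqrt ((u - 1 / 2) ^+ 2 + (v - 1 / 2) ^+ 2) ^+ k).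
Let radius := mean (fun u v _ _ => Num.sqrt (u ^+ 2 + v ^+ 2) ^+ k).
Let rho : R := Num.sqrt (1 / 2) ^+ k.

Let scale (x y : R) : x = 1 / 2 * y -> Num.sqrt x ^+ k = rho * Num.sqrt y ^+ k.
Proof. by move=> ->; rewrite sqrtrM ?exprMn//; lra. Qed.

(** Both similarities send the origin to [c2] and shrink distances by [sqrt 2]. *)
Lemma distance_c2E : distance_c2 = rho * radius.
Proof.
rewrite /radius -Z; last by bounded_measurable.
apply: (mean_average _ J_rectangle) => [|u v u' v'|]; try by bounded_measurable.
rewrite mulr_natl mulr2n; congr (_ + _); apply: scale; by field.
Qed.

(** Formally [half_upper] at [(u, v)] is [half_lower] at [(u, - v)]. Hence points in the same half
    reproduce [distance], points in different halves give [distance_across], and each case occurs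
    twice among the four. *)
Lemma distanceE : (2 - rho) * distance = rho * distance_across.
Proof.
pose F (u v u' v' : R) : R := Num.sqrt ((u - u') ^+ 2 + (v - v') ^+ 2) ^+ k.
have bF : bounded_measurable F by rewrite /F; bounded_measurable.
have bl := bounded_measurable_half_lower _ bF.
have bu := bounded_measurable_half_upper _ bF.
have E0 := mean_halves _ J_rectangle _ bF.
have E1 := mean_halves_snd _ J_rectangle _ bl.
have E2 := mean_halves_snd _ J_rectangle _ bu.
have same g : (forall u v u' v', g u v u' v' = rho * F u v u' v') -> mean g = rho * distance.
  by move=> gE; rewrite /distance -Z//; exact: mean_eq.
have across g : (forall u v u' v',
    g u v u' v' = rho * Num.sqrt ((u - u') ^+ 2 + (v + v') ^+ 2) ^+ k) ->
    mean g = rho * distance_across.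
  by move=> gE; rewrite /distance_across -Z; [exact: mean_eq|bounded_measurable].
have {}E1 : 2 * mean (fun u v => F ((1 - u + v) / 2) ((1 - u - v) / 2)) =
    rho * distance + rho * distance_across.
  rewrite E1; congr (_ + _); [apply: same|apply: across] => u v u' v';
    by apply: scale; field.
have {}E2 : 2 * mean (fun u v => F ((1 - u - v) / 2) ((1 - u + v) / 2)) =
    rho * distance_across + rho * distance.
  rewrite E2; congr (_ + _); [apply: across|apply: same] => u v u' v';
    by apply: scale; field.
rewrite -/F in E0 *; rewrite -/distance in E0; lra.
Qed.

(** Bernoulli at [3 * r] with [r >= v]; the factor 3 makes the mean of the lower bound equal to 1,
    since [v] has mean [1 / 3]. Positivity supplies the strictness for exponents above 1. *)
Lemma radius_gt0 : 0 < radius.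
Proof.
have : mean (fun u v _ _ => 1 - k%:R + 3 * k%:R * v) <=
    mean (fun u v _ _ => 3 ^+ k * Num.sqrt (u ^+ 2 + v ^+ 2) ^+ k).
  apply: (mean_le _ J_rectangle) => [||u v _ _ u0 v0 _ _ _ _]; try by bounded_measurable.
  have vr : v <= Num.sqrt (u ^+ 2 + v ^+ 2) by rewrite le_sqrt// lerDr sqr_ge0.
  rewrite -exprMn; apply: le_trans (bernoulli _ k _); last by rewrite mulr_ge0.
  have : k%:R * v <= k%:R * Num.sqrt (u ^+ 2 + v ^+ 2) by rewrite ler_wpM2l.
  by move=> ?; nra.
expand; rewrite (mean_v _ J_rectangle) (mean_u _ J_rectangle) -/radius => H.
have {H} : 1 <= 3 ^+ k * radius by apply: le_trans H; lra.
by move=> H; rewrite -(pmulr_rgt0 _ (x := 3 ^+ k)) ?exprn_gt0// (lt_le_trans _ H).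
Qed.

Lemma radius_le_distance_across : (1 < k)%N -> 2 * radius <= distance_across.
Proof.
move=> k1.
pose G (u v u' v' : R) : R := Num.sqrt ((u - u') ^+ 2 + (v + v') ^+ 2) ^+ k.
have bG : bounded_measurable G by rewrite /G; bounded_measurable.
have bG' := bounded_measurable_swap _ bG.
have E : mean (fun u v u' v' => G v u v' u') = distance_across.
  by rewrite (mean_swap_snd _ J_rectangle _ bG') (mean_swap _ J_rectangle _ bG).
have radius' : mean (fun _ _ u' v' => Num.sqrt (u' ^+ 2 + v' ^+ 2) ^+ k) = radius.
  apply: (mean_exchange _ J_rectangle (fun u v _ _ => Num.sqrt (u ^+ 2 + v ^+ 2) ^+ k)).
  by bounded_measurable.
suff : mean (fun u v u' v' =>
      2 * (Num.sqrt (u ^+ 2 + v ^+ 2) ^+ k + Num.sqrt (u' ^+ 2 + v' ^+ 2) ^+ k)) <=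
    mean (fun u v u' v' => G u v u' v' + G v u v' u').
  rewrite D; [|exact: bG|by rewrite /G; bounded_measurable].
  rewrite E Z ?D ?radius' -/radius -/distance_across; try by bounded_measurable.
  by lra.
apply: (mean_le _ J_rectangle) => [||u v u' v' *]; rewrite /G; try by bounded_measurable.
case: k k1 => [|[|n]]// _.
(* [m ^ 2] is the sum of the squared radii and also the average of the two squared distances on the
   right, whose cross terms [2 * (v * v' - u * u')] have opposite signs. *)
set m := Num.sqrt (u ^+ 2 + v ^+ 2 + (u' ^+ 2 + v' ^+ 2)).
have S0 (x y : R) : 0 <= x ^+ 2 + y ^+ 2 by rewrite addr_ge0 ?sqr_ge0.
have S1 : 0 <= u ^+ 2 + v ^+ 2 + (u' ^+ 2 + v' ^+ 2) by rewrite addr_ge0.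
apply: (le_trans (y := 2 * m ^+ n.+2)).
  rewrite ler_wpM2l// power_superadditive ?sqrtr_ge0//.
  by rewrite !sqr_sqrtr.
apply: power_mean_ge_quadratic; rewrite ?sqrtr_ge0// !sqr_sqrtr//.
by ring.
Qed.

Lemma radius_lt_distance_across1 : k = 1%N -> (2 - rho) * radius < distance_across.
Proof.
move=> k1; rewrite /rho /radius /distance_across k1.
(* Cauchy-Schwarz against the unit vector [(5 / 13, 12 / 13)], whose direction is close to that of
   the means [4 / 15] of [|u - u'|] and [2 / 3] of [v + v']. The lower bound has mean [28 / 39]. *)
have : mean (fun u v u' v' => 12 / 13 * v + 12 / 13 * v' + 5 / 13 * `|u - u'|) <=
    mean (fun u v u' v' => Num.sqrt ((u - u') ^+ 2 + (v + v') ^+ 2) ^+ 1).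
  apply: (mean_le _ J_rectangle) => [||u v u' v' *]; try by bounded_measurable.
  rewrite expr1 le_sqrt// -(real_normK (num_real (u - u'))) -subr_ge0.
  rewrite (_ : _ - _ = ((12 * `|u - u'| - 5 * (v + v')) / 13) ^+ 2); last by field.
  exact: sqr_ge0.
expand; rewrite (mean_v _ J_rectangle) (mean_u _ J_rectangle) (mean_v_snd _ J_rectangle).
rewrite (mean_distance_u _ J_rectangle) => across_ge.
have : mean (fun u v _ _ => Num.sqrt (u ^+ 2 + v ^+ 2) ^+ 1) <=
    mean (fun u v _ _ => 61 / 60 * u + 61 / 60 * v - 3 * (u * v) +
      15 / 8 * (u * u * v) + 15 / 8 * (u * v * v)).
  apply: (mean_le _ J_rectangle) => [||u v u' v' *]; try by bounded_measurable.
  by rewrite expr1 hypotenuse_le.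
expand; rewrite (mean_v _ J_rectangle) (mean_u _ J_rectangle) (mean_uv _ J_rectangle).
rewrite (mean_uuv _ J_rectangle) (mean_uvv _ J_rectangle) => radius_le.
(* The last step needs [(2 - w) * (199 / 360) < 28 / 39], that is, [w] above about 0.7012;
   [1403 / 2000] lies between this and [sqrt (1 / 2)]. *)
have sqrt_half : 1403 / 2000 <= Num.sqrt (1 / 2) :> R by rewrite le_sqrt// expr2; lra.
have sqrt_half_le : Num.sqrt (1 / 2) <= 1 :> R by rewrite -[leRHS]sqrtr1 ler_wsqrtr//; lra.
rewrite expr1; move: sqrt_half sqrt_half_le radius_le across_ge.
set w := Num.sqrt _; set x := mean _; set y := mean _ => w1 w2 xle yge.
(* [199 / 360] is the mean of the polynomial bound on the radius. *)
apply: (le_lt_trans (y := (2 - w) * (199 / 360))); last by lra.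
by rewrite ler_wpM2l ?subr_ge0//; lra.
Qed.

Lemma distance_c2_lt_distance : (0 < k)%N -> distance_c2 < distance.
Proof.
move=> k0.
have rho_gt0 : 0 < rho by rewrite exprn_gt0// sqrtr_gt0; lra.
have rho_le1 : rho <= 1.
  by rewrite exprn_ile1 ?sqrtr_ge0// -[leRHS]sqrtr1 ler_wsqrtr//; lra.
have key : (2 - rho) * radius < distance_across.
  have [k1|k1] := ltnP 1 k; last by apply: radius_lt_distance_across1; apply/eqP; rewrite eqn_leq k1.
  apply: lt_le_trans (radius_le_distance_across k1).
  by rewrite ltr_pM2r ?radius_gt0//; lra.
(* After multiplication by [2 - rho], both sides carry the common factor [rho], and [key]
   remains. *)
rewrite -(ltr_pM2l (x := 2 - rho)); last by lra.
by rewrite distanceE distance_c2E mulrCA ltr_pM2l.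
Qed.

End Comparison.

Theorem proposition1 (R : realType)
  (d : measure_display) (Om : measurableType d) (P : probability Om R)
  (X0 X1 : {RV P >-> plane R})
  (hX0 : uniform_in X0 T2) (hX1 : uniform_in X1 T2)
  (hX : independent_points X0 X1)
  (d' : measure_display) (Om' : measurableType d') (Q : probability Om' R)
  (Y : {RV Q >-> plane R}) (hY : uniform_in Y T2)
  (k : nat) (hk : (0 < k)%N) :
  ('E_Q[(fun w => eucl_dist (Y w) c2 ^+ k)%R] <
   'E_P[(fun w => eucl_dist (X0 w) (X1 w) ^+ k)%R])%E.
Proof.
have mX : measurable_fun setT (fun w => (X0 w, X1 w)) by exact: measurable_fun_pair.
pose X : {RV P >-> (plane R * plane R)%type} :=
  HB.pack (fun w => (X0 w, X1 w)) (isMeasurableFun.Build _ _ _ _ _ mX).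
have uniX : independent_uniform (distribution P X).
  move=> A B mA mB; transitivity (P (X0 @^-1` A `&` X1 @^-1` B)) => //.
  by rewrite hX//; congr (_ * _)%E; [exact: hX0|exact: hX1].
have lt := distance_c2_lt_distance _ uniX _ hk.
move: lt; set f := (X in mean _ X < _); set g := (X in _ < mean _ X) => lt.
have bf : bounded_measurable f by rewrite /f; bounded_measurable.
have bg : bounded_measurable g by rewrite /g; bounded_measurable.
have mf : measurable_fun setT (fun z : plane R * plane R =>
  (f z.1.1 z.1.2 z.2.1 z.2.2)%:E) by apply/measurable_EFinP; exact: bf.1.
have mg : measurable_fun setT (fun z : plane R * plane R =>
  (g z.1.1 z.1.2 z.2.1 z.2.2)%:E) by apply/measurable_EFinP; exact: bg.1.
have -> : ('E_P[(fun w => eucl_dist (X0 w) (X1 w) ^+ k)%R] = (mean (distribution P X) g)%:E)%E.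
  rewrite unlock -(EFin_mean _ uniX)// ge0_integral_distribution// => z.
  by rewrite lee_fin exprn_ge0.
(* [Y] may live on another probability space, but it has the same law as [X0], so its expectation is
   a mean over the first point of the joint law. *)
have -> : ('E_Q[(fun w => eucl_dist (Y w) c2 ^+ k)%R] = (mean (distribution P X) f)%:E)%E.
  pose h (x : plane R) : \bar R := (eucl_dist x c2 ^+ k)%:E.
  have h0 x : (0 <= h x)%E by rewrite lee_fin exprn_ge0 ?sqrtr_ge0.
  have mh : measurable_fun setT h.
    have mi : measurable_fun setT (fun x : plane R => (x, c2) : plane R * plane R).
      by apply: measurable_fun_pair; [exact: measurable_id|exact: measurable_cst].
    exact: (measurableT_comp mf mi).
  rewrite unlock -(EFin_mean _ uniX)// ge0_integral_distribution//; last first.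
    by move=> z; rewrite lee_fin exprn_ge0.
  rewrite -[LHS](ge0_integral_distribution Y mh h0) -[RHS](ge0_integral_distribution X0 mh h0).
  by apply: eq_measure_integral => A mA _; exact: etrans (hY _ mA) (esym (hX0 _ mA)).
by rewrite lte_fin.
Qed.
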